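(* Let $\Gamma$ be a countable group. Then for every positive integer $d$, $$\dim\big(([0,1]^d)^\Gamma,\mathrm{shift}\big)=d.$$
   Context: For a compact metrizable space $K$, $K^\Gamma$ is the space of functions $\Gamma\to K$ with the product topology (a compact metrizable space), and $\mathrm{shift}$ is the action of $\Gamma$ on $K^\Gamma$ by homeomorphisms given by $(\mathrm{shift}_\gamma(x))_{\gamma'}=x_{\gamma^{-1}\gamma'}$. For an action $T$ of a countable discrete group $\Gamma$ by homeomorphisms of a compact metric (metrizable) space $X$, $\mathrm{Prob}(X,T)$ is the set of $T$-invariant Borel probability measures on $X$; $\mathrm{Cov}(X)$ is the set of finite open covers of $X$; $\mathcal{V}\succeq\mathcal{U}$ means every $V\in\mathcal{V}$ is contained in some $U\in\mathcal{U}$; $\mathrm{ord}(\mathcal{V},x)=-1+\sum_{V\in\mathcal{V}}\mathbf{1}_V(x)$; and $$\dim(X,T)=\sup_{\mathcal{U}\in\mathrm{Cov}(X)}\ \inf_{\mathcal{V}\in\mathrm{Cov}(X),\,\mathcal{V}\succeq\mathcal{U}}\ \sup_{\mu\in\mathrm{Prob}(X,T)}\int_X \mathrm{ord}(\mathcal{V},x)\,d\mu(x),$$ with $\dim(X,T)=-\infty$ if $\mathrm{Prob}(X,T)=\emptyset$. *)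

(* Defs.v *)
From HB Require Import structures.
From mathcomp Require Import all_boot all_order all_algebra.
From mathcomp Require Import all_classical all_reals all_analysis.

Set Implicit Arguments.
Unset Strict Implicit.
Unset Printing Implicit Defensive.

Import Order.TTheory GRing.Theory Num.Theory.
Import numFieldNormedType.Exports.

Local Open Scope classical_set_scope.
Local Open Scope ring_scope.

(* The map [homeo_act T g] is a homeomorphism, with inverse
   [homeo_act T g^-1]. *)
Record homeo_action (G : groupType) (X : topologicalType) := HomeoAction {
  homeo_act :> G -> X -> X;
  homeo_act1 : forall x, homeo_act 1%g x = x;
  homeo_actM : forall g h x, homeo_act (g * h)%g x = homeo_act g (homeo_act h x);
  homeo_act_continuous : forall g, continuous (homeo_act g) }.

(* The library's measurable types are pointed, hence the restriction to
   nonempty (pointed) topological spaces from here on. *)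
Notation borel X := (g_sigma_algebraType (@open X)).

Section dimension.
Variables (R : realType) (G : groupType) (X : ptopologicalType).
Implicit Types U V : set (set X).

Definition invariant_prob (T : homeo_action G X) : set (probability (borel X) R) :=
  [set mu | forall (g : G) (A : set (borel X)), measurable A ->
              mu (T g @^-1` A) = mu A].

Definition finite_open_cover : set (set (set X)) :=
  [set V | [/\ finite_set V, (forall A, V A -> open A) &
               \bigcup_(A in V) A = [set: X]]].

Definition refines V U := forall A, V A -> exists2 B, U B & A `<=` B.

Definition cover_ord V (x : X) : R := - 1 + \sum_(A \in V) (\1_A x : R).

(* If there is no invariant probability, then the innermost supremum is that of
   the empty set, i.e. -oo, and the value is -oo. *)
Definition dyn_dim (T : homeo_action G X) : \bar R :=
  ereal_sup [set ereal_inf [set ereal_sup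
      [set (\int[mu]_x (cover_ord V x)%:E)%E | mu in invariant_prob T]
    | V in [set V | finite_open_cover V /\ refines V U]]
  | U in finite_open_cover].

End dimension.

Section shift.
Variables (G : groupType) (K : topologicalType).

Definition shift_map (g : G) (x : {ptws G -> K}) : {ptws G -> K} :=
  fun h => x (g^-1 * h)%g.

Lemma shift_map1 x : shift_map 1%g x = x.
Proof. by apply/funext => h; rewrite /shift_map invg1 mul1g. Qed.

Lemma shift_mapM g h x : shift_map (g * h)%g x = shift_map g (shift_map h x).
Proof. by apply/funext => k; rewrite /shift_map invgM mulgA. Qed.

Lemma shift_map_continuous g : continuous (shift_map g).
Proof.
move=> x; apply/cvg_sup; first exact/fmap_filter/nbhs_filter.
move=> h; move: x.
apply: (@continuous_comp_initial _ {ptws G -> K} K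
  (fun y : forall _ : G, K => y h) (shift_map g)).
exact: (@proj_continuous G (fun=> K) (g^-1 * h)%g).
Qed.

Definition shift_action : homeo_action G {ptws G -> K} :=
  HomeoAction shift_map1 shift_mapM shift_map_continuous.

End shift.

Definition unit_interval (R : realType) : Type :=
  set_type (`[0, 1]%classic : set R).

HB.instance Definition _ (R : realType) := Topological.on (unit_interval R).

Lemma unit_interval0 (R : realType) : (0 : R) \in (`[0, 1]%classic : set R).
Proof. by apply/mem_set; rewrite /= in_itv /= lexx ler01. Qed.

HB.instance Definition _ (R : realType) :=
  isPointed.Build (unit_interval R) (exist _ 0 (unit_interval0 R)).

HB.instance Definition _ (I : Type) (T : I -> ptopologicalType) :=
  Pointed.on (prod_topology T).

Definition unit_cube (R : realType) (d : nat) : Type :=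
  {ptws 'I_d -> unit_interval R}.

HB.instance Definition _ (R : realType) (d : nat) :=
  Pointed.on (unit_cube R d).
HB.instance Definition _ (R : realType) (d : nat) :=
  Topological.on (unit_cube R d).

(* Main.v *)
Require Import Defs.
From HB Require Import structures.
From mathcomp Require Import all_boot all_order all_algebra all_fingroup.
From mathcomp Require Import all_classical all_reals all_analysis.
From mathcomp Require Import measurable_realfun zify ring lra.

(** Write X for the space of configurations x : G -> [0,1]^d.  The equality is
    proved as two inequalities.

    The lower bound lives on the constant configurations.  They are fixed by
    the shift, so the Dirac mass at each of them is invariant, and integrating
    the order of a cover against it gives the order at that point.  The constant
    configurations form a copy of the cube [0,1]^d, and Lebesgue's covering
    theorem says that a finite open cover of the cube, none of whose members
    meets two opposite faces, has a point lying in d + 1 members, hence of order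
    at least d.  So the cover [range wall_avoiding] cannot be refined by a cover
    whose order integrates to less than d ([lebesgue_covering], [dyn_dim_ge]).
    Lebesgue's theorem is derived from Kuhn's cubical form of Sperner's lemma
    ([cubical_sperner]), proved by a parity count over the simplices
    v, v + e_a, v + e_a + e_b, ... of a subdivided cube.

    For the upper bound, compactness shows that a cover of X is refined by every
    cover whose members are small in finitely many real coordinates, indexed by
    s * {1..d} with s a finite subset of G ([lebesgue_number]).  Mark on the
    axis of each coordinate j a fine arithmetic progression.  Then there is a
    fine open cover of X of which a point x lies in at most 1 + n(x) members,
    where n(x) counts the coordinates of x that are very close to a mark
    ([cover_ord_stagger]).  The order of this cover is thus at most a sum, over
    the coordinates, of indicator functions of closeness to a mark.  The crucial
    choice is to translate the progressions so that, for a given axis i, the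
    neighbourhoods of the marks used for the different elements of s are
    pairwise disjoint subsets of [0,1].  An invariant measure gives the closeness
    event at the element g of s the probability of the same event at 1, so for
    each axis the probabilities of disjoint events are summed, and the total is
    at most 1 ([sum_window]).  Adding over the d axes, the order integrates to
    at most d for all invariant measures at once ([integral_stagger],
    [dyn_dim_le]). *)

Set Implicit Arguments.
Unset Strict Implicit.
Unset Printing Implicit Defensive.

(** * Doors: parity of the almost completely labelled facets of a simplex *)

(** [f] exchanges the part of [D] where [b] holds with the part where it
    fails, so both have the same size. *)
Lemma even_card_flip (T : finType) (D : {set T}) (f : T -> T) (b : pred T) :
  injective f -> {in D, forall p, (f p \in D) && (b (f p) == ~~ b p)} ->
  ~~ odd #|D|.
Proof.
move=> f_inj fD; rewrite -(cardsID [set p | b p] D).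
suff -> : #|D :&: [set p | b p]| = #|D :\: [set p | b p]| by rewrite oddD addbb.
apply/eqP; rewrite eqn_leq -[X in X <= _ <= _](card_imset _ f_inj).
rewrite -[X in _ && (X <= _)](card_imset _ f_inj).
by apply/andP; split; apply/subset_leq_card/fintype.subsetP => _ /imsetP[p + ->];
  rewrite !inE => /andP[]; [move=> pD bp|move=> bp pD];
  move: (fD p pD) => /andP[-> /eqP ->]; rewrite bp.
Qed.

(** A labelling [g] of the m + 1 vertices of a simplex; the facet opposite to the
    vertex [k] is a door if it carries all the labels 0, ..., m - 1. *)
Definition door (m : nat) (g : 'I_m.+1 -> nat) (k : 'I_m.+1) :=
  [forall j : 'I_m, exists k', (k' != k) && (g k' == j)].
Definition onto (m : nat) (g : 'I_m.+1 -> nat) :=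
  [forall j : 'I_m.+1, exists k, g k == j].

Lemma doorP m g k :
  reflect (forall j, j < m -> exists2 k', k' != k & g k' = j) (@door m g k).
Proof.
apply: (iffP forallP) => [H j jm|H j].
  by have /existsP[k' /andP[nk /eqP]] := H (Ordinal jm); exists k'.
by have [k' nk gk] := H j (ltn_ord j); apply/existsP; exists k'; rewrite nk gk eqxx.
Qed.

Lemma ontoP m g :
  reflect (forall j, j <= m -> exists k, g k = j) (@onto m g).
Proof.
apply: (iffP forallP) => [H j jm|H j].
  by have /existsP[k' /eqP] := H (Ordinal (jm : j < m.+1)); exists k'.
by have [k' gk] := H j (ltn_ord j); apply/existsP; exists k'; rewrite gk eqxx.
Qed.

Lemma onto_inj m (g : 'I_m.+1 -> nat) :
  (forall k, g k <= m) -> onto g -> injective g.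
Proof.
move=> gm /ontoP og.
pose h k : 'I_m.+1 := Ordinal (gm k : g k < m.+1).
suff h_inj : injective h by move=> x y gxy; apply/h_inj/val_inj.
suff hT : h @: [set: 'I_m.+1] = [set: 'I_m.+1].
  have /imset_injP hi : #|h @: [set: 'I_m.+1]| == #|[set: 'I_m.+1]| by rewrite hT.
  by move=> x y; apply: hi; rewrite inE.
apply/setP => j; rewrite [RHS]inE; have [k gk] := og j (ltn_ord j).
by apply/imsetP; exists k => //; apply: val_inj.
Qed.

(** A completely labelled simplex has one door, opposite to its vertex labelled
    m.  Otherwise, if there is a door, then the vertex opposite to it repeats the
    label of one other vertex, and removing either of these two, and nothing else,
    leaves a door. *)
Lemma odd_doors m (g : 'I_m.+1 -> nat) :
  (forall k, g k <= m) -> odd #|[set k | door g k]| = onto g.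
Proof.
move=> gm; have [og|nog] := boolP (onto g).
  have g_inj := onto_inj gm og.
  have [k0 gk0] := (ontoP _ og) m (leqnn m).
  suff -> : [set k | door g k] = [set k0] by rewrite cards1.
  apply/setP => k; rewrite !inE; apply/doorP/eqP => [dk|-> j jm].
    have := gm k; rewrite leq_eqVlt => /predU1P[gk|/dk[k' nk /g_inj kk]].
      by apply: g_inj; rewrite gk0.
    by rewrite kk eqxx in nk.
  have [k' gk'] := (ontoP _ og) j (ltnW jm); exists k' => //.
  by apply: contraTneq jm => kk; rewrite -gk' kk gk0 ltnn.
have [->|[k0]] := finset.set_0Vmem [set k | door g k]; first by rewrite cards0.
rewrite inE => /doorP dk0.
have gk0 : g k0 < m.
  rewrite ltn_neqAle gm andbT; apply: contra nog => /eqP gk0.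
  apply/ontoP => j; rewrite leq_eqVlt => /predU1P[->|/dk0[k _ gk]]; first by exists k0.
  by exists k.
have [k1 k10 gk1] := dk0 _ gk0.
suff -> : [set k | door g k] = [set k0; k1] by rewrite cards2 eq_sym k10.
apply/setP => k; rewrite !inE; apply/doorP/orP => [dk|[]/eqP -> // j jm]; last first.
  have [k' k'0 gk'] := dk0 j jm; have [k'1|k'1] := eqVneq k' k1; last by exists k'.
  by exists k0; rewrite 1?eq_sym // -gk' k'1 gk1.
(* A third door would leave m labels on the m - 1 vertices other than k and k0. *)
apply/orP; apply: contraT; rewrite negb_or => /andP[nk0 nk1].
pose h k : 'I_m.+1 := Ordinal (gm k : g k < m.+1).
have : [set~ ord_max] \subset h @: ~: [set k; k0].
  apply/fintype.subsetP => j; rewrite !inE => jmax.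
  have jm : j < m by rewrite ltn_neqAle -ltnS ltn_ord andbT.
  have [k' k'k gk'] := dk j jm; apply/imsetP.
  have [k'0|k'0] := eqVneq k' k0.
    exists k1; first by rewrite !inE negb_or eq_sym nk1.
    by apply: val_inj; rewrite /= gk1 -gk' k'0.
  by exists k'; [rewrite !inE negb_or k'k|apply: val_inj].
move=> /subset_leq_card/leq_trans/(_ (leq_imset_card _ _)).
rewrite cardsC1 card_ord cardsCs finset.setCK card_ord cards2 nk0 /=; lia.
Qed.

(** * Kuhn's cubical Sperner lemma *)

Section Kuhn.
Variables (d n : nat) (lab : {ffun 'I_d -> nat} -> nat).
Hypothesis lab_le : forall v, lab v <= d.
Hypothesis lab0 : forall (v : {ffun 'I_d -> nat}) i, v i = 0 -> lab v != i.
Hypothesis labn : forall (v : {ffun 'I_d -> nat}) i, v i = n -> lab v <= i.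

(** A pair (v, t) encodes the simplex with vertices v_0 < v_1 < ... in which v_0
    = v and v_k is obtained by raising by 1 the coordinates i with t i < k; so
    t i is the time at which coordinate i moves. *)
Let simplex := ({ffun 'I_d -> 'I_n.+1} * 'S_d)%type.

Definition vert (p : simplex) (k : nat) : {ffun 'I_d -> nat} :=
  [ffun i => p.1 i + (p.2 i < k)].

(** The simplices of dimension m of the face where all the coordinates of index
    at least m equal n.  On this face all labels are at most m, so that Sperner's
    induction can run through these faces, from the corner m = 0 to the whole
    cube m = d. *)
Definition valid m (p : simplex) := [forall i : 'I_d,
  if i < m then p.1 i < n else (p.1 i == n :> nat) && (p.2 i == i)].

Definition labs m (p : simplex) : 'I_m.+1 -> nat := fun k => lab (vert p k).
Definition full m (p : simplex) := onto (@labs m p).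

Lemma valid_lt m (p : simplex) (i : 'I_d) : valid m p -> i < m -> p.1 i < n.
Proof. by move=> /forallP /(_ i) + im; rewrite im. Qed.

Lemma valid_ge m (p : simplex) (i : 'I_d) : valid m p -> m <= i -> p.1 i = n :> nat.
Proof. by move=> /forallP /(_ i) + im; rewrite ltnNge im => /andP[/eqP]. Qed.

Lemma valid_fix m (p : simplex) (i : 'I_d) : valid m p -> m <= i -> p.2 i = i.
Proof. by move=> /forallP /(_ i) + im; rewrite ltnNge im => /andP[_ /eqP]. Qed.

Lemma valid_pos m (p : simplex) (i : 'I_d) : valid m p -> (p.2 i < m) = (i < m).
Proof.
move=> vp; have [mi|im] := leqP m i; first by rewrite (valid_fix vp) // ltnNge mi.
rewrite ltnNge; apply/negP => le.
by have /perm_inj pi := valid_fix vp le; rewrite pi leqNgt im in le.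
Qed.

Lemma labs_le m p (k : 'I_m.+1) : m <= d -> valid m p -> labs p k <= m.
Proof.
move=> md vp; move: md; rewrite leq_eqVlt => /predU1P[mE|md].
  by apply: leq_trans (lab_le _) _; rewrite mE.
apply: (@labn _ (Ordinal md)); rewrite ffunE (valid_ge vp) //=.
by rewrite (valid_fix vp) //= ltnNge -ltnS ltn_ord addn0.
Qed.

(** Exchanging the steps k - 1 and k replaces the vertex k only, and so pairs off
    the simplices having a given facet opposite to k. *)
Lemma even_inner_doors m (k : 'I_m.+1) : m <= d -> 0 < k < m ->
  ~~ odd #|[set p | valid m p && door (labs p) k]|.
Proof.
move=> md /andP[k0 km].
have kd : k < d by exact: leq_trans md.
have kd' : k.-1 < d by apply: leq_ltn_trans kd; exact: leq_pred.
pose a := Ordinal kd'; pose b := Ordinal kd.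
pose f (p : simplex) : simplex := (p.1, (p.2 * tperm a b)%g).
pose s (p : simplex) := (p.2^-1%g a < p.2^-1%g b).
have f_inj : injective f by move=> [v t] [v' t'] [-> /mulIg ->].
have ab : a != b by rewrite -val_eqE /=; lia.
apply: (even_card_flip (b := s) f_inj) => p; rewrite !inE => /andP[vp /doorP dp].
apply/andP; split; last first.
  rewrite /s /f /= !invMg !permM tpermV tpermL tpermR -leqNgt ltn_neqAle.
  by rewrite (inj_eq val_inj) (inj_eq perm_inj) (eq_sym b) ab eqxx.
apply/andP; split.
  apply/forallP => i; rewrite /=; have := forallP vp i; case: ifP => // /negbT.
  rewrite -leqNgt => mi /andP[-> /eqP pi] /=; rewrite permM pi tpermD //.
    by rewrite -val_eqE /=; lia.
  by rewrite -val_eqE /=; lia.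
have vert_f k' : k' != k :> nat -> vert (f p) k' = vert p k'.
  move=> k'k; apply/ffunP => i; rewrite !ffunE /= permM.
  by case: tpermP => [->|->|//] /=; congr (_ + nat_of_bool _); lia.
apply/doorP => j /dp[k' k'k <-]; exists k' => //.
by rewrite /labs vert_f.
Qed.

(** The facets opposite to the first and the last vertex.  [rot] drops the first
    vertex and repeats its step at the end: it passes to the simplex on the other
    side of the facet opposite to the first vertex, which then is opposite to the
    last one. *)
Section rotation.
Variable m' : 'I_d.
Local Notation m := m'.+1.

Definition rotf (x : 'I_d) : 'I_d :=
  if x == 0 :> nat then m' else if x <= m' then insubd x x.-1 else x.

Lemma val_rotf x :
  rotf x = (if x == 0 :> nat then m' : nat else if x <= m' then x.-1 else x) :> nat.
Proof.
rewrite /rotf; case: ifP => // _; case: ifP => // _.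
by rewrite val_insubd; have := ltn_ord x; case: ifP => //; lia.
Qed.

Lemma rotf_inj : injective rotf.
Proof.
move=> x y /(congr1 val); rewrite /= !val_rotf => H; apply: val_inj => /=; move: H.
do ?case: ifP; lia.
Qed.

Let c : 'S_d := perm rotf_inj.

Lemma val_c x :
  c x = (if x == 0 :> nat then m' : nat else if x <= m' then x.-1 else x) :> nat.
Proof. by rewrite permE val_rotf. Qed.

Definition rot (p : simplex) : simplex :=
  ([ffun i => if p.2 i == 0 :> nat then inord (p.1 i).+1 else p.1 i], (p.2 * c)%g).

Definition unrot (p : simplex) : simplex :=
  ([ffun i => if p.2 i == m' then inord (p.1 i).-1 else p.1 i], (p.2 * c^-1)%g).

Lemma eq0_c (x : 'I_d) : (x == 0 :> nat) = (c x == m').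
Proof.
rewrite -val_eqE /= permE val_rotf; do ?case: ifP; have := ltn_ord m'; lia.
Qed.

Lemma vert_rot p k : valid m p -> k <= m' -> vert (rot p) k = vert p k.+1.
Proof.
move=> vp km; apply/ffunP => i; rewrite !ffunE /= permM val_c.
case: ifP => [/eqP p0|p0].
  rewrite inordK ?p0; first by rewrite !ltnNge km leq0n addn0 addn1.
  by rewrite ltnS; apply: (valid_lt vp); rewrite -(valid_pos _ vp) p0.
congr (_ + nat_of_bool _); case: ifP; lia.
Qed.

Lemma rotK p : valid m p -> unrot (rot p) = p.
Proof.
case: p => v t vp; congr pair; last by rewrite /= mulgK.
apply/ffunP => i; rewrite !ffunE /= permM -eq0_c; case: eqP => // t0.
have vn : v i < n by apply: (valid_lt vp); rewrite -(valid_pos _ vp) /= t0.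
by apply: val_inj; rewrite /= inordK inordK //= ltnS (leq_trans (leq_pred _)).
Qed.

Lemma unrotK (p : simplex) : (forall i, p.2 i = m' -> 0 < p.1 i) -> rot (unrot p) = p.
Proof.
case: p => v t /= vp; congr pair; last by rewrite /= mulgKV.
apply/ffunP => i; rewrite !ffunE /= permM eq0_c permKV.
case: eqP => // t0; have := vp _ t0; have := ltn_ord (v i) => vn v0.
apply: val_inj; rewrite /= inordK inordK //; lia.
Qed.

Lemma door_full p : valid m p -> door (labs p) (ord0 : 'I_m.+1) = full m' (rot p).
Proof.
move=> vp; apply/doorP/ontoP => H j /H.
  move=> [k k0 <-]; have k0' : 0 < k by rewrite lt0n; exact: k0.
  have km : k.-1 < m by have := ltn_ord k; lia.
  by exists (Ordinal km); rewrite /labs vert_rot ?prednK.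
move=> [k <-]; exists (lift ord0 k) => //.
by rewrite /labs vert_rot // -ltnS.
Qed.

Lemma door_max p : door (labs p) (ord_max : 'I_m.+1) = full m' p.
Proof.
apply/doorP/ontoP => H j /H.
  move=> [k k0 <-]; have km : k < m.
    by have := ltn_ord k; rewrite -val_eqE /= in k0 *; lia.
  by exists (Ordinal km).
move=> [k <-]; exists (widen_ord (leqnSn m) k) => //.
by rewrite -val_eqE /= neq_ltn ltn_ord.
Qed.

(** If [rot] leaves the cube, then the facet lies on a face where some coordinate
    i0 equals n, all labels there are at most i0, and a door needs the label m':
    hence i0 = m' and the facet is a simplex of the next lower dimension. *)
Lemma rot_valid p : valid m p -> full m' (rot p) ->
  valid m (rot p) || valid m' (rot p).
Proof.
move=> vp fp.
have m0 : 0 < d by case: (m') => x /= ; lia.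
pose i0 := p.2^-1%g (Ordinal m0).
have pi0 : p.2 i0 = 0 :> nat by rewrite permKV.
have i0m : i0 < m by rewrite -(valid_pos _ vp) pi0.
have eqi0 i : p.2 i = 0 :> nat -> i = i0.
  by move=> pi; apply: (@perm_inj _ p.2); apply: val_inj; rewrite /= pi pi0.
have vi0 : p.1 i0 < n := valid_lt vp i0m.
have v'i0 : (rot p).1 i0 = (p.1 i0).+1 :> nat by rewrite ffunE pi0 eqxx inordK.
have v'i i : i != i0 -> (rot p).1 i = p.1 i.
  by move=> ii; rewrite ffunE; case: ifP => // /eqP /eqi0 ii0; rewrite ii0 eqxx in ii.
have fixm (i : 'I_d) : m <= i -> (rot p).2 i = i.
  move=> mi; rewrite permM (valid_fix vp) //; apply: val_inj.
  rewrite /= val_c; do ?case: ifP; lia.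
have [lt|ge] := ltnP (p.1 i0).+1 n; [apply/orP; left|apply/orP; right].
  apply/forallP => i; case: ifP => im.
    by have [->|ii] := eqVneq i i0; [rewrite v'i0|rewrite v'i // (valid_lt vp)].
  have mi : m <= i by rewrite leqNgt im.
  rewrite fixm // eqxx andbT v'i ?(valid_ge vp) //.
  by apply: contraFneq im => ->.
have v'n : (rot p).1 i0 = n :> nat by rewrite v'i0; apply/eqP; rewrite eqn_leq ge vi0.
have i0E : i0 = m'.
  apply/eqP; rewrite -val_eqE /= eqn_leq -ltnS i0m /=.
  have [k <-] := (ontoP _ fp) m' (leqnn _).
  apply: labn; rewrite ffunE v'n permM val_c pi0 eqxx.
  by rewrite ltnNge -ltnS ltn_ord addn0.
apply/forallP => i; case: ifP => im.
  have ii : i != i0 by apply: contraTneq im => ->; rewrite i0E ltnn.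
  by rewrite v'i // (valid_lt vp) // ltnW.
have [->|ii] := eqVneq i i0.
  by rewrite v'n eqxx /= permM i0E -eq0_c -i0E pi0.
have mi : m <= i.
  rewrite ltn_neqAle leqNgt im andbT eq_sym; apply: contra_neq ii => H.
  by apply: val_inj; rewrite /= H i0E.
by rewrite fixm // eqxx andbT v'i ?(valid_ge vp).
Qed.

(** No door lies on a face where a coordinate i0 vanishes, because the label i0
    is missing there; so one can step back through it. *)
Lemma unrot_valid q : full m' q -> valid m q || valid m' q ->
  valid m (unrot q) /\ rot (unrot q) = q.
Proof.
move=> fq vq.
pose i0 := q.2^-1%g m'.
have qi0 : q.2 i0 = m' by rewrite permKV.
have fixm (i : 'I_d) : m <= i -> q.2 i = i.
  by case/orP: vq => vq mi; apply: (valid_fix vq) => //; exact: ltnW.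
have gem (i : 'I_d) : m <= i -> q.1 i = n :> nat.
  by case/orP: vq => vq mi; apply: (valid_ge vq) => //; exact: ltnW.
have i0m : i0 < m.
  by rewrite ltnNge; apply/negP => /[dup] /fixm; rewrite qi0 => <-; rewrite ltnn.
have eqi0 i : q.2 i = m' -> i = i0.
  by move=> pi; apply: (@perm_inj _ q.2); rewrite pi qi0.
have w0 : 0 < q.1 i0.
  rewrite lt0n; apply/negP => /eqP w0.
  have [k labk] := (ontoP _ fq) i0 i0m.
  suff /(@lab0 _ i0)/negP : vert q k i0 = 0 by apply; apply/eqP.
  by rewrite ffunE w0 qi0 ltnNge -ltnS ltn_ord.
split; last by apply: unrotK => i /eqi0 ->.
apply/forallP => i; case: ifP => im.
  rewrite ffunE; case: ifP => [/eqP/eqi0 ->|qi].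
    by rewrite inordK; have := ltn_ord (q.1 i0); lia.
  case/orP: vq => vq; first exact: (valid_lt vq).
  apply: (valid_lt vq); rewrite ltn_neqAle -ltnS im andbT.
  apply/negP => /eqP /val_inj im'.
  by move: qi; rewrite (valid_fix vq) im' ?eqxx.
have mi : m <= i by rewrite leqNgt im.
rewrite ffunE permM fixm // ifF.
  rewrite gem // eqxx /=; apply/eqP; apply: (@perm_inj _ c); rewrite permKV.
  apply: val_inj; rewrite /= val_c; do ?case: ifP; lia.
by apply/negbTE; rewrite -val_eqE /=; lia.
Qed.

Lemma card_end_doors :
  #|[set p | valid m p && door (labs p) (ord0 : 'I_m.+1)]| =
  #|[set p | valid m p && door (labs p) (ord_max : 'I_m.+1)]|
  + #|[set p | valid m' p && full m' p]|.
Proof.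
set A := [set p | _]; set B := [set p | _]; set C := [set p | _].
have BC : B :&: C = finset.set0.
  apply/setP => p; rewrite !inE; apply/negP => /andP[/andP[vp _] /andP[vp' _]].
  by have := valid_lt vp (ltnSn m'); rewrite (valid_ge vp') ?ltnn.
have -> : #|B| + #|C| = #|B :|: C| by rewrite cardsU BC cards0 subn0.
have inBC q : (q \in B :|: C) = full m' q && (valid m q || valid m' q).
  by rewrite !inE door_max -andb_orl andbC.
apply/eqP; rewrite eqn_leq; apply/andP; split.
  rewrite -(@card_in_imset _ _ rot A); last first.
    move=> p q; rewrite !inE => /andP[vp _] /andP[vq _] pq.
    by rewrite -(rotK vp) pq rotK.
  apply/subset_leq_card/fintype.subsetP => _ /imsetP[p + ->].
  by rewrite inBC inE => /andP[vp]; rewrite door_full // => fp; rewrite fp rot_valid.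
rewrite -(@card_in_imset _ _ unrot (B :|: C)); last first.
  move=> p q; rewrite !inBC => /andP[fp vp] /andP[fq vq] pq.
  have [_ <-] := unrot_valid fp vp; rewrite pq.
  by have [_ ->] := unrot_valid fq vq.
apply/subset_leq_card/fintype.subsetP => _ /imsetP[p + ->].
rewrite inBC inE => /andP[fp vp]; have [vp' rp] := unrot_valid fp vp.
by rewrite vp' door_full // rp.
Qed.

(** Sum the number of doors over all simplices.  By [odd_doors] this has the
    parity of the number of completely labelled simplices.  The inner doors cancel
    by [even_inner_doors], and by [card_end_doors] the first and the last ones
    cancel except for the completely labelled simplices of lower dimension. *)
Lemma odd_full_step : odd #|[set p | valid m p && full m p]| =
  odd #|[set p | valid m' p && full m' p]|.
Proof.
have md : m <= d := ltn_ord m'.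
have -> : odd #|[set p | valid m p && full m p]| =
    odd (\sum_(p | valid m p) #|[set k | door (labs p : 'I_m.+1 -> nat) k]|).
  rewrite -sum1_card (big_morph odd oddD (erefl _)).
  rewrite (big_morph odd oddD (erefl _)).
  under eq_bigl do rewrite inE.
  rewrite big_mkcondr; apply: eq_bigr => p vp; rewrite odd_doors.
    by rewrite /full; case: onto.
  by move=> k; exact: labs_le.
under eq_bigr do rewrite -sum1_card.
under eq_bigr do under eq_bigl do rewrite inE.
rewrite (exchange_big_dep xpredT) //=.
have E k : \sum_(p | valid m p && door (labs p : 'I_m.+1 -> nat) k) 1 =
   #|[set p | valid m p && door (labs p : 'I_m.+1 -> nat) k]|.
  by rewrite -sum1_card; apply: eq_bigl => p; rewrite inE.
under eq_bigr do rewrite E.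
rewrite big_ord_recl big_ord_recr /= !oddD (big_morph odd oddD (erefl _)) big1.
  rewrite addFb (_ : lift ord0 ord_max = ord_max); last exact: val_inj.
  by rewrite card_end_doors oddD addbAC addbb.
by move=> k _; apply/negbTE/even_inner_doors => //=; rewrite /bump /= add1n ltnS.
Qed.

End rotation.

Lemma odd_full m : m <= d -> odd #|[set p | valid m p && full m p]|.
Proof.
elim: m => [_|m IH md]; last by rewrite (@odd_full_step (Ordinal md)) IH // ltnW.
suff -> : [set p | valid 0 p && full 0 p] = [set ([ffun=> ord_max], 1%g)].
  by rewrite cards1.
apply/setP => -[v t]; rewrite !inE; apply/andP/eqP => [[vp _]|[-> ->]].
  congr pair.
    by apply/ffunP => i; rewrite ffunE; apply: val_inj; rewrite /= (valid_ge vp).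
  by apply/permP => i; rewrite (valid_fix vp) // perm1.
set p := ([ffun=> ord_max], 1%g).
have vp : valid 0 p by apply/forallP => i; rewrite /= ffunE perm1 !eqxx.
split=> //; apply/ontoP => j; rewrite leqn0 => /eqP ->; exists ord0.
by apply/eqP; rewrite -leqn0 labs_le.
Qed.

Lemma cubical_sperner : exists v : {ffun 'I_d -> nat}, forall j, j <= d ->
  exists2 w : {ffun 'I_d -> nat}, lab w = j & forall i, v i <= w i <= (v i).+1.
Proof.
have : #|[set p | valid d p && full d p]| != 0.
  by apply: contraTneq (odd_full (leqnn d)) => ->.
rewrite cards_eq0 => /finset.set0Pn[p]; rewrite inE => /andP[_ /ontoP fp].
exists (vert p 0) => j /fp[k <-]; exists (vert p k) => // i; rewrite !ffunE ltn0 addn0.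
by rewrite leq_addr; case: (_ < _); rewrite ?addn0 ?addn1 ?leqnSn ?leqnn.
Qed.
End Kuhn.

Import Order.TTheory GRing.Theory Num.Theory.
Import numFieldNormedType.Exports.
Local Open Scope classical_set_scope.
Local Open Scope ring_scope.

(** * The space of configurations *)

Lemma compact_set_type (T : topologicalType) (A : set T) :
  compact A -> compact [set: set_type A].
Proof.
move=> cA F FF _.
have /cA [p [Ap clp]] : (set_val @ F) A.
  suff : F (set_val @^-1` A) by [].
  by apply: filterS (filterT : F setT) => x _; exact: set_valP.
exists (exist _ p (mem_set Ap)); split=> // B W FB [_ [[W0 oW0 <-] /= W0p W0W]].
have FB' : F (set_val @^-1` (set_val @` B)) by apply: filterS FB => x Bx; exists x.
have [_ [[x Bx <-] W0x]] := clp _ _ FB' (open_nbhs_nbhs (conj oW0 W0p)).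
by exists x; split=> //; exact: W0W.
Qed.

Section configurations.
Variables (R : realType) (G : groupType) (d : nat).
Local Notation X := {ptws G -> unit_cube R d}.
Implicit Types (x y : X) (s : seq G) (e : R).

Definition coord (h : G) (i : 'I_d) (x : X) : R := set_val (x h i).

Lemma coord01 h i x : 0 <= coord h i x <= 1.
Proof. by have := set_valP (x h i); rewrite /= in_itv. Qed.

Lemma coord_continuous h i : continuous (coord h i).
Proof.
move=> x; apply: (@continuous_comp X (unit_interval R) R^o
  (fun y : X => y h i) set_val); last exact: initial_continuous.
apply: (@continuous_comp X (unit_cube R d) (unit_interval R)
  (fun y : X => y h) (fun z => z i)).
  exact: (@proj_continuous G (fun=> unit_cube R d) h).
exact: (@proj_continuous 'I_d (fun=> unit_interval R) i).
Qed.

Lemma compact_configurations : compact [set: X].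
Proof.
have -> : [set: X] = [set x : X | forall h, [set: unit_cube R d] (x h)].
  by apply/seteqP; split.
apply: (@tychonoff G (fun=> unit_cube R d) (fun=> setT)) => _.
have -> : [set: unit_cube R d] =
    [set z : unit_cube R d | forall i, [set: unit_interval R] (z i)].
  by apply/seteqP; split.
apply: (@tychonoff 'I_d (fun=> unit_interval R) (fun=> setT)) => _.
exact/compact_set_type/segment_compact.
Qed.

Definition near_config s e x : set X :=
  [set y | forall h i, h \in s -> `|coord h i x - coord h i y| < e].

(** The sets [near_config s e x] generate a filter which converges to [x] for the
    product topology, since it does so in each coordinate. *)
Lemma nbhs_near_config x (A : set X) :
  nbhs x A -> exists s e, 0 < e /\ near_config s e x `<=` A.
Proof.
pose F : set_system X := filter_from [set p : seq G * R | 0 < p.2]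
  (fun p => near_config p.1 p.2 x).
have FF : Filter F.
  apply: filter_from_filter; first by exists ([::], 1) => /=.
  move=> [s e] [s' e'] /= e0 e'0; exists (s ++ s', Num.min e e').
    by rewrite /= lt_min e0.
  move=> y xy; split=> h i hs; have /= := xy h i; rewrite mem_cat hs ?orbT lt_min.
    by move=> /(_ isT)/andP[].
  by move=> /(_ isT)/andP[].
suff Fx : F --> x by move=> /Fx[[s e] /= e0 sub]; exists s, e.
apply/cvg_sup => h B0 [_ [[B oB <-] /= Bx BA]].
suff FB : F [set y : X | B (y h)] by apply: filterS FB => y; exact: BA.
suff: (fun y : X => y h) @ F --> x h by apply; exact: open_nbhs_nbhs.
apply/cvg_sup => i C0 [_ [[C oC <-] /= Cx CA]].
suff FC : F [set y : X | C (y h i)] by apply: filterS FC => y; exact: CA.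
move: oC Cx => [D oD <-] /= Dx.
have /nbhs_ballP[e /= e0 De] := open_nbhs_nbhs (conj oD Dx).
exists ([:: h], e) => //= y xy; apply: De => /=.
by apply: xy; rewrite mem_head.
Qed.

Lemma near_config_nbhs s e x : 0 < e -> nbhs x (near_config s e x).
Proof.
move=> e0; elim: s => [|h s IH].
  by rewrite (_ : near_config _ _ _ = setT); [exact: filterT|apply/seteqP; split].
suff : nbhs x [set y | forall i, `|coord h i x - coord h i y| < e].
  move=> /filterI/(_ IH); apply: filterS => y [xhy xy] g i.
  by rewrite inE => /predU1P[->|/xy].
apply: (@filter_forall X 'I_d
  (fun i y => `|coord h i x - coord h i y| < e) (nbhs x)) => i.
have := @coord_continuous h i x.
by move=> /cvgrPdist_lt/(_ e e0).
Qed.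

(** Lebesgue's number lemma; the scale is a pair of a finite set of group elements
    and a positive real. *)
Lemma lebesgue_number (V : set (set X)) : finite_open_cover V ->
  exists s e, 0 < e /\ forall x, exists2 A, V A & near_config s e x `<=` A.
Proof.
move=> [_ Vo VT].
pose F : set_system (seq G * R) := filter_from [set p : seq G * R | 0 < p.2]
  (fun p => [set q : seq G * R | {subset p.1 <= q.1} /\ 0 < q.2 <= p.2]).
have FF : ProperFilter F.
  apply: filter_from_proper => [|[s e] /= e0]; last first.
    by exists (s, e); split; rewrite //= e0 lexx.
  apply: filter_from_filter; first by exists ([::], 1) => /=.
  move=> [s e] [s' e'] /= e0 e'0; exists (s ++ s', Num.min e e').
    by rewrite /= lt_min e0.
  move=> q [/= sq /andP[-> /=]]; rewrite le_min => /andP[-> ->].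
  by split; split=> // h hs; apply: sq; rewrite mem_cat hs ?orbT.
have /compact_near_coveringP nc := compact_configurations.
pose P (q : seq G * R) (x : X) :=
  0 < q.2 /\ exists2 A, V A & near_config q.1 q.2 x `<=` A.
suff /nc : forall x, [set: X] x -> \forall x' \near x & q \near F, P q x'.
  case=> [[s e] /= e0 /(_ (s, e))] /= H; exists s, e; split=> // x.
  by have [|_] := H _ x I; [split; rewrite //= e0 lexx|].
move=> x _; have : setT x by []. rewrite -VT => -[A VA Ax].
have [s [e [e0 sub]]] := nbhs_near_config (open_nbhs_nbhs (conj (Vo A VA) Ax)).
exists (near_config s (e / 2) x,
  [set q : seq G * R | {subset s <= q.1} /\ 0 < q.2 <= e / 2]).
  split=> /=; last by exists (s, e / 2) => //=; rewrite divr_gt0.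
  by apply: near_config_nbhs; rewrite divr_gt0.
move=> [y q] /= [xy [sq /andP[q0 qe]]]; split=> //; exists A => // z yz.
apply: sub => h i hs; rewrite (splitr e).
apply: le_lt_trans (ler_distD (coord h i y) _ _) _.
by rewrite ltrD ?xy // (lt_le_trans _ qe) // yz // sq.
Qed.
End configurations.

(** * The order of a cover *)

Lemma open_forall (T : topologicalType) (I : finType) (A : I -> set T) :
  (forall i, open (A i)) -> open [set x | forall i, A i x].
Proof.
move=> Ao; rewrite openE => x Ax.
by apply: (@filter_forall T I A (nbhs x)) => i; exact: open_nbhs_nbhs.
Qed.

Section cover_order.
Variables (R : realType) (X : ptopologicalType).
Implicit Types (V : set (set X)) (x : X).

Lemma cover_ordE V x : finite_set V ->
  cover_ord R V x = (count (fun A => x \in A) (finmap.enum_fset (fset_set V)))%:R - 1.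
Proof.
move=> finV; rewrite /cover_ord addrC fsbig_finite //=; congr (_ - 1).
rewrite -sum1_count natr_sum [RHS]big_mkcond /=.
by apply: eq_bigr => A _; rewrite indicE; case: (x \in A).
Qed.

Lemma cover_ord_ge0 V x : finite_open_cover V -> 0 <= cover_ord R V x.
Proof.
move=> [finV _ VT]; rewrite cover_ordE // subr_ge0 ler1n -has_count; apply/hasP.
have : setT x by []. rewrite -VT => -[A VA Ax].
by exists A; [rewrite in_fset_set // inE|rewrite inE].
Qed.

Lemma cover_ord_lbound V x n (A_ : 'I_n.+1 -> set X) : finite_set V ->
  injective A_ -> (forall i, V (A_ i) /\ A_ i x) -> n%:R <= cover_ord R V x.
Proof.
move=> finV A_inj VA; rewrite cover_ordE // lerBrDr natr1 ler_nat -size_filter.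
rewrite (_ : n.+1 = size (map A_ (enum 'I_n.+1))); last first.
  by rewrite size_map size_enum_ord.
apply: uniq_leq_size; first by rewrite map_inj_uniq // enum_uniq.
move=> _ /mapP[i _ ->]; have [Vi Ai] := VA i.
by rewrite mem_filter in_fset_set //; apply/andP; split; rewrite inE.
Qed.

Lemma cover_ord_ubound V x (P : finType) (B : P -> set X) n : finite_set V ->
  V `<=` range B -> (#|[pred p | x \in B p]| <= n.+1)%N -> cover_ord R V x <= n%:R.
Proof.
move=> finV VB le; rewrite cover_ordE // lerBlDr natr1 ler_nat -size_filter.
apply: leq_trans le; rewrite -(size_image B).
apply: uniq_leq_size; first by rewrite filter_uniq // finmap.fset_uniq.
move=> A; rewrite mem_filter in_fset_set // => /andP[xA]; rewrite inE => /VB[p _ BpA].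
by rewrite -BpA in xA *; apply: fintype.image_f; rewrite unfold_in /= xA.
Qed.

Lemma measurable_cover_ord V : finite_open_cover V ->
  measurable_fun [set: borel X] (cover_ord R V : borel X -> R).
Proof.
move=> [finV Vo _]; have -> : cover_ord R V =
    fun x => -1 + \sum_(A <- finmap.enum_fset (fset_set V))
      \1_(if A \in V then A else set0) x.
  apply/funext => x; rewrite /cover_ord fsbig_finite //=; congr (_ + _).
  by apply: eq_big_seq => A; rewrite in_fset_set //= => ->.
apply: measurable_funD => //; apply: measurable_sum => A.
apply: measurable_indic; case: ifPn => // VA; apply: sub_sigma_algebra.
by apply: Vo; move: VA; rewrite inE.
Qed.
Lemma integral_cover_ord_le (mu : probability (borel X) R) V (J : finType)
    (E : J -> set X) : finite_open_cover V -> (forall j, open (E j)) ->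
  (forall x, cover_ord R V x <= \sum_j \1_(E j) x) ->
  (\int[mu]_x (cover_ord R V x)%:E <= \sum_j mu (E j))%E.
Proof.
move=> Vc Eo ordE.
have mE j : measurable (E j : set (borel X)) by apply: sub_sigma_algebra; exact: Eo.
have mindic j : measurable_fun [set: borel X] (EFin \o (\1_(E j) : borel X -> R)).
  by apply/measurable_EFinP; exact: measurable_indic.
apply: (@le_trans _ _ (\int[mu]_x \sum_j (\1_(E j) x)%:E)%E).
  apply: ge0_le_integral => //.
  - by move=> x _; rewrite lee_fin; exact: cover_ord_ge0.
  - by apply/measurable_EFinP; exact: measurable_cover_ord.
  - exact: emeasurable_sum.
  - by move=> x _; rewrite sumEFin lee_fin; exact: ordE.
rewrite ge0_integral_sum //; under eq_bigr do rewrite integral_indic // setIT.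
exact: lexx.
Qed.
End cover_order.

(** * Lebesgue's covering theorem on constant configurations *)

Section lower_bound.
Variables (R : realType) (G : groupType) (d : nat).
Local Notation X := {ptws G -> unit_cube R d}.

Lemma clamp_in01 (t : R) : Num.min 1 (Num.max 0 t) \in (`[0, 1]%classic : set R).
Proof.
apply/mem_set; rewrite /= in_itv /=; apply/andP; split; last by rewrite ge_min lexx.
by rewrite le_min ler01 le_max lexx.
Qed.

Definition clamp (t : R) : unit_interval R :=
  exist (fun x => x \in (`[0, 1]%classic : set R)) _ (clamp_in01 t).

(** The grid points v / n of the cube, as constant configurations.  Clamping makes
    them defined for all integral [v], which spares bounds in the labelling. *)
Definition grid_config (n : nat) (v : {ffun 'I_d -> nat}) : X :=
  fun _ i => clamp ((v i)%:R / n%:R).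

Lemma grid_config_fixed n v (g : G) :
  shift_action G (unit_cube R d) g (grid_config n v) = grid_config n v.
Proof. by []. Qed.

Lemma coord_grid n v h i :
  coord h i (grid_config n v) = Num.min 1 (Num.max 0 ((v i)%:R / n%:R)).
Proof. by []. Qed.

(** For each axis i the set avoids one of the two faces orthogonal to it: the face
    x_i = 1 if [b i], the face x_i = 0 otherwise. *)
Definition wall_avoiding (b : {ffun 'I_d -> bool}) : set X :=
  [set x | forall i, if b i then coord 1%g i x < 1 else 0 < coord 1%g i x].

Lemma open_wall_avoiding b : open (wall_avoiding b).
Proof.
apply: open_forall => i; case: (b i).
  by apply: (@open_comp _ _ (coord 1%g i) [set t | t < 1]);
    [move=> x _; exact: coord_continuous|exact: open_lt].
by apply: (@open_comp _ _ (coord 1%g i) [set t | 0 < t]);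
  [move=> x _; exact: coord_continuous|exact: open_gt].
Qed.

Lemma wall_avoiding_cover : finite_open_cover (range wall_avoiding).
Proof.
split.
- exact/finite_image/finite_finset.
- by move=> _ [b _ <-]; exact: open_wall_avoiding.
- apply/seteqP; split=> // x _.
  exists (wall_avoiding [ffun i => coord 1%g i x < 1]).
    by exists [ffun i => coord 1%g i x < 1].
  move=> i; rewrite ffunE; case: ifP => // /negbT; rewrite -leNgt.
  exact: lt_le_trans.
Qed.

(** Attach to each grid point w a member A w of the cover containing a whole ball
    around it, and label w by the first axis along which A w is allowed to touch
    the face x_i = 1 (by d if there is none).  This is a Kuhn labelling, so some
    cell of the grid has vertices with d + 1 different labels, hence with d + 1
    different members A w, each of which contains the corner v of the cell. *)
Lemma lebesgue_covering (V : set (set X)) : finite_open_cover V ->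
  refines V (range wall_avoiding) ->
  exists n v, d%:R <= cover_ord R V (grid_config n v).
Proof.
move=> Vc Vref; have [s [e [e0 leb]]] := lebesgue_number Vc.
have [finV Vo VT] := Vc.
have [n [n0 ne]] : exists n : nat, (0 < n)%N /\ n%:R^-1 < e.
  have := near_infty_natSinv_lt (PosNum e0) => -[n _ /(_ n (leqnn n))] /= ne.
  by exists n.+1.
pose A w := sval (cid2 (leb (grid_config n w))).
have VA w : V (A w) by rewrite /A; case: cid2.
have subA w : near_config s e (grid_config n w) `<=` A w by rewrite /A; case: cid2.
have Aw w : A w (grid_config n w).
  by apply: subA => h i _; rewrite subrr normr0.
(* The sign vector is chosen as a function of the member B, not of the vertex w,
   so that different labels force different members. *)
pose bb B := xget [ffun=> true] [set b | B `<=` wall_avoiding b].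
have bbP w : A w `<=` wall_avoiding (bb (A w)).
  have [_ [b _ <-] sub] := Vref _ (VA w).
  apply: (@xgetPex _ [ffun=> true] [set b | A w `<=` wall_avoiding b]).
  by exists b.
pose l B := find (fun i => ~~ bb B i) (enum 'I_d).
have ld B : (l B <= d)%N by rewrite -[leqRHS]size_enum_ord find_size.
have l0 (w : {ffun 'I_d -> nat}) (i : 'I_d) : w i = 0%N -> l (A w) != i.
  move=> wi; apply/negP => /eqP li.
  have /(nth_find i) : has (fun i => ~~ bb (A w) i) (enum 'I_d).
    by rewrite has_find -/(l (A w)) li size_enum_ord.
  rewrite -/(l (A w)) li nth_ord_enum => /negbTE bi.
  have := bbP w _ (Aw w) i; rewrite bi coord_grid wi mul0r.
  by rewrite maxxx min_r ?ler01 // ltxx.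
have ln (w : {ffun 'I_d -> nat}) (i : 'I_d) : w i = n -> (l (A w) <= i)%N.
  move=> wi; rewrite leqNgt; apply/negP => /(before_find i).
  rewrite nth_ord_enum => /negbFE bi.
  have := bbP w _ (Aw w) i; rewrite bi coord_grid wi divff ?pnatr_eq0 ?gtn_eqF //.
  by rewrite max_r ?ler01 // minxx ltxx.
have [v vP] := cubical_sperner (lab := fun w => l (A w)) (fun w => ld _) l0 ln.
exists n, v.
have /choice[w wP] : forall j : 'I_d.+1, exists w : {ffun 'I_d -> nat},
    l (A w) = j /\ forall i, (v i <= w i <= (v i).+1)%N.
  by move=> j; have [w] := vP j (ltn_ord j); exists w.
apply: (@cover_ord_lbound _ _ _ _ _ (fun j => A (w j))) => //.
  by move=> j k jk; apply: val_inj; rewrite /= -(wP j).1 -(wP k).1 jk.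
move=> j; split; first exact: VA.
apply: subA => h i _; rewrite !coord_grid.
have [_ /(_ i)/andP[vw wv]] := wP j.
apply: le_lt_trans ne.
have {}vw : ((v i)%:R / n%:R : R) <= (w j i)%:R / n%:R.
  by rewrite ler_pM2r ?invr_gt0 ?ltr0n // ler_nat.
have {}wv : (w j i)%:R / n%:R <= (v i)%:R / n%:R + n%:R^-1 :> R.
  by rewrite -[X in _ + X]mul1r -mulrDl natr1 ler_pM2r ?invr_gt0 ?ltr0n // ler_nat.
have v0 : 0 <= (v i)%:R / n%:R :> R by rewrite divr_ge0.
rewrite !max_r ?(le_trans v0) // /Num.min ler_distlC.
by do 2![case: ifP => [|/negbT]; rewrite -?leNgt => ?]; apply/andP; split; lra.
Qed.
End lower_bound.

(** * A cover by pieces with few overlaps *)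

Lemma open_and (T : topologicalType) (P Q : T -> Prop) :
  open [set x | P x] -> open [set x | Q x] -> open [set x | P x /\ Q x].
Proof. exact: openI. Qed.

Section pieces.
Variables (R : realType) (T : topologicalType) (J : finType) (N : nat) (r : R).
Variable y : J -> T -> R.
Hypothesis y_cont : forall j, continuous (y j).
Hypothesis y_ge0 : forall j x, 0 <= y j x.
Hypothesis y_lt : forall j x, y j x < N%:R.
Hypothesis r_gt0 : 0 < r.
Hypothesis r_le : r <= 2^-1.

(** Let S = p.1 and a = p.2.  The coordinates in S are close to the integers a j,
    the others lie strictly between a j and a j + 1, and every coordinate in S is
    closer to the integers than every coordinate outside S.  The last condition
    makes the sets S of the pieces through a given point a chain, as for the open
    stars of the vertices of a barycentric subdivision. *)
Definition piece (p : {set J} * {ffun J -> 'I_N}) : set T :=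
  [set x | forall jk : J * J,
  let: (j, k) := jk in
  (if j \in p.1 then `|y j x - (p.2 j)%:R| < r : Prop
   else (p.2 j)%:R < y j x /\ y j x < (p.2 j)%:R + 1) /\
  (j \in p.1 -> k \notin p.1 ->
   `|y j x - (p.2 j)%:R| < y k x - (p.2 k)%:R /\
   `|y j x - (p.2 j)%:R| < (p.2 k)%:R + 1 - y k x)].

Definition near_integer (j : J) : set T :=
  [set x | exists a : nat, `|y j x - a%:R| < r].

Lemma open_ltfun (f g : T -> R) :
  continuous f -> continuous g -> open [set x | f x < g x].
Proof.
move=> fc gc; rewrite (_ : [set x | _] = (fun x => g x - f x) @^-1` [set t | 0 < t]).
  apply: open_comp; last exact: open_gt.
  by move=> x _; apply: (@continuousB R R^o T); [exact: gc|exact: fc].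
by apply/seteqP; split=> x /=; rewrite subr_gt0.
Qed.

Lemma open_near_integer j : open (near_integer j).
Proof.
rewrite (_ : near_integer j = \bigcup_(a in [set: nat]) [set x | `|y j x - a%:R| < r]).
  apply: bigcup_open => a _; apply: open_ltfun => x; last exact: cst_continuous.
  apply: (@continuous_comp T R^o R^o (fun x => y j x - a%:R) (fun z => `|z|));
    last exact: norm_continuous.
  by apply: (@continuousB R R^o T); [exact: y_cont|exact: cst_continuous].
by apply/seteqP; split=> [x [a]|x [a _]]; exists a.
Qed.

Lemma open_piece p : open (piece p).
Proof.
have yBc j (a : R) : continuous (fun x => y j x - a).
  by move=> x; apply: (@continuousB R R^o T); [exact: y_cont|exact: cst_continuous].
have yBc' j (a : R) : continuous (fun x => a - y j x).
  by move=> x; apply: (@continuousB R R^o T); [exact: cst_continuous|exact: y_cont].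
have yNc j (a : R) : continuous (fun x => `|y j x - a|).
  move=> x; apply: (@continuous_comp T R^o R^o (fun x => y j x - a) (fun z => `|z|)).
    exact: yBc.
  exact: norm_continuous.
apply: open_forall => -[j k]; apply: open_and.
  have cc (a : R) : continuous (fun _ : T => a) by move=> x; exact: cst_continuous.
  by case: (j \in p.1); [|apply: open_and]; apply: open_ltfun.
have [jS|jS] := boolP (j \in p.1); last first.
  by rewrite (_ : [set x | _] = setT); [exact: openT|apply/seteqP; split].
have [kS|kS] := boolP (k \in p.1).
  by rewrite (_ : [set x | _] = setT); [exact: openT|apply/seteqP; split].
rewrite (_ : [set x | _] = [set x | `|y j x - (p.2 j)%:R| < y k x - (p.2 k)%:R /\
   `|y j x - (p.2 j)%:R| < (p.2 k)%:R + 1 - y k x]).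
  by apply: open_and; apply: open_ltfun.
by apply/seteqP; split=> x /= H //; exact: H.
Qed.

(** Take for S the set of the coordinates of x that are integers. *)
Lemma pieces_cover x : exists p, piece p x.
Proof.
have yP j := truncn_itv (y_ge0 j x).
have aN j : (Num.truncn (y j x) < N)%N.
  have /andP[ay _] := yP j.
  by rewrite -(ltr_nat R) (le_lt_trans ay).
exists ([set j | y j x == (Num.truncn (y j x))%:R]%SET, [ffun j => Ordinal (aN j)]).
move=> [j k]; rewrite !inE !ffunE /=; split.
  case: eqP => [yE|/eqP ne]; first by rewrite -yE subrr normr0.
  by have /andP[+ +] := yP j; rewrite le_eqVlt eq_sym (negbTE ne) -natr1.
move=> /eqP <- ne; rewrite subrr normr0 !subr_gt0.
by have /andP[+ +] := yP k; rewrite le_eqVlt eq_sym (negbTE ne) -natr1.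
Qed.

Lemma piece_in p x j : piece p x -> j \in p.1 -> `|y j x - (p.2 j)%:R| < r.
Proof. by move=> /(_ (j, j))[+ _] jS; rewrite jS. Qed.

Lemma piece_notin p x j : piece p x -> j \notin p.1 ->
  (p.2 j)%:R < y j x /\ y j x < (p.2 j)%:R + 1.
Proof. by move=> /(_ (j, j))[+ _] /negbTE jS; rewrite jS. Qed.

Lemma piece_gap p x j k : piece p x -> j \in p.1 -> k \notin p.1 ->
   `|y j x - (p.2 j)%:R| < y k x - (p.2 k)%:R /\
   `|y j x - (p.2 j)%:R| < (p.2 k)%:R + 1 - y k x.
Proof. by move=> /(_ (j, k))[_ +] jS kS; exact. Qed.

Lemma leq_of_ltD1 (a b : nat) : a%:R < b%:R + 1 :> R -> (a <= b)%N.
Proof. by rewrite natr1 ltr_nat. Qed.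

(** The integers attached to a coordinate by two pieces, one counting it as close
    to an integer and the other not, are compared by this; it lets both pieces
    measure the same distance to the integers. *)
Lemma nearest_cases (a b : nat) (t : R) : `|t - a%:R| < 2^-1 ->
  b%:R < t -> t < b%:R + 1 ->
  a%:R = b%:R :> R \/ a%:R = b%:R + 1 :> R.
Proof.
move=> /ltr_normlP[ta at_] bt tb.
have ab : (a <= b.+1)%N by apply: leq_of_ltD1; rewrite -natr1; lra.
have ba : (b <= a)%N by apply: leq_of_ltD1; lra.
have [->|->] : a = b \/ a = b.+1 by lia.
  by left.
by right; rewrite natr1.
Qed.

(** If j belonged to the first set only and k to the second only, then y_j would
    be both strictly closer and strictly farther from the integers than y_k. *)
Lemma piece_chain p q x : piece p x -> piece q x ->
  (p.1 \subset q.1) || (q.1 \subset p.1).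
Proof.
move=> px qx; apply: contraT; rewrite negb_or => /andP[].
move=> /fintype.subsetPn[j jp jq] /fintype.subsetPn[k kq kp].
have [pj1 pj2] := piece_gap px jp kp; have [qk1 qk2] := piece_gap qx kq jq.
have [qj1 qj2] := piece_notin qx jq; have [pk1 pk2] := piece_notin px kp.
have pj := lt_le_trans (piece_in px jp) r_le.
have qk := lt_le_trans (piece_in qx kq) r_le.
have ej := nearest_cases pj qj1 qj2; have ek := nearest_cases qk pk1 pk2.
have := ler_norm (y j x - (p.2 j)%:R); have := ler_norm (y k x - (q.2 k)%:R).
have := ler_norm (- (y j x - (p.2 j)%:R)); have := ler_norm (- (y k x - (q.2 k)%:R)).
rewrite !normrN => *.
by case: ej ek => [ej|ej] [ek|ek]; lra.
Qed.

Lemma piece_eq p q x : piece p x -> piece q x -> p.1 = q.1 -> p = q.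
Proof.
case: p q => [S a] [S' b] px qx /= SS'; rewrite -SS' in qx *; congr pair.
apply/ffunP => j; apply: val_inj => /=; apply/eqP; rewrite eqn_leq.
have [jS|jS] := boolP (j \in S).
  have := lt_le_trans (piece_in px jS) r_le; have := lt_le_trans (piece_in qx jS) r_le.
  move=> /= /ltr_normlP[? ?] /ltr_normlP[? ?].
  by apply/andP; split; apply: leq_of_ltD1; lra.
have [/= ? ?] := piece_notin px jS; have [/= ? ?] := piece_notin qx jS.
by apply/andP; split; apply: leq_of_ltD1; lra.
Qed.

(** The common piece confines both values to an interval of length 1. *)
Lemma piece_diam p x x' j : piece p x -> piece p x' -> `|y j x - y j x'| < 1.
Proof.
move=> px px'; have [jS|jS] := boolP (j \in p.1).
  have := lt_le_trans (piece_in px jS) r_le; have := lt_le_trans (piece_in px' jS) r_le.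
  by move=> /= /ltr_normlP[? ?] /ltr_normlP[? ?]; apply/ltr_normlP; split; lra.
have [/= ? ?] := piece_notin px jS; have [/= ? ?] := piece_notin px' jS.
by apply/ltr_normlP; split; lra.
Qed.

(** The sets S of the pieces through x form a chain of subsets of the set W of the
    coordinates close to an integer, and S determines the piece; so the pieces are
    separated by the size of S, which is at most #|W|. *)
Lemma card_pieces x : (#|[pred p | x \in piece p]| <=
  (\sum_j (x \in near_integer j)).+1)%N.
Proof.
set W := [set j | x \in near_integer j]%SET.
have -> : (\sum_j (x \in near_integer j))%N = #|W|.
  rewrite -sum1_card big_mkcond [RHS]big_mkcond /=; apply: eq_bigr => j _.
  by rewrite inE; case: (_ \in _).
have SW p : piece p x -> p.1 \subset W.
  move=> px; apply/fintype.subsetP => j jS; rewrite !inE.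
  by exists (p.2 j); exact: piece_in.
rewrite -[X in (_ <= X)%N]card_ord.
pose f (p : {set J} * {ffun J -> 'I_N}) : 'I_(#|W|).+1 := inord #|p.1|.
apply: (@leq_card_in _ _ f).
move=> p q; rewrite !unfold_in /= !inE => px qx /(congr1 val).
rewrite /= !inordK ?ltnS ?subset_leq_card ?SW // => pq.
apply: (piece_eq px qx); case/orP: (piece_chain px qx) => sub.
  by apply/eqP; rewrite eqEcard sub pq leqnn.
by apply/esym/eqP; rewrite eqEcard sub pq leqnn.
Qed.
End pieces.

(** * The staggered cover and its integral *)

Section upper_bound.
Variables (R : realType) (G : groupType) (d : nat).
Local Notation X := ({ptws G -> unit_cube R d} : ptopologicalType).
Variables (s : seq G) (M : nat).

(* Each axis is rescaled by M, and the k-th group element of s uses a grid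
   translated by k / q; the windows of radius r = 1 / 2q around the marks are
   then disjoint for different k.  Any positive q at least size s would do, and the
   successor is positive even if s is empty. *)
Let q := (size s).+1.
Let r : R := (2 * q%:R)^-1.
Let J := ('I_(size s) * 'I_d)%type.

(** The summand 1 keeps the value nonnegative, so that the marks are the natural
    numbers. *)
Definition offset (k : nat) (t : R) : R := M%:R * t + 1 - k%:R / q%:R.

Definition stagger (j : J) (x : X) : R := offset j.1 (coord (nth 1%g s j.1) j.2 x).

Let q_gt0 : 0 < q%:R :> R. Proof. by rewrite ltr0n. Qed.
Let r_gt0 : 0 < r. Proof. by rewrite invr_gt0 mulr_gt0. Qed.
Let r_le : r <= 2^-1.
Proof. by rewrite lef_pV2 ?posrE ?mulr_gt0 // ler_peMr // ler1n. Qed.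

Lemma continuous_offset (k : nat) (h : G) (i : 'I_d) :
  continuous (fun x : X => offset k (coord h i x)).
Proof.
move=> x; apply: (@continuousB R R^o X (fun x => M%:R * coord h i x + 1));
  last exact: cst_continuous.
apply: (@continuousD R R^o X (fun x => M%:R * coord h i x));
  last exact: cst_continuous.
apply: (@continuousM R X (fun=> M%:R) (coord h i)); first exact: cst_continuous.
exact: coord_continuous.
Qed.

Lemma offset_bounds (k : nat) (h : G) (i : 'I_d) (x : X) : (k < size s)%N ->
  0 <= offset k (coord h i x) < M.+2%:R.
Proof.
move=> ks; have /andP[c0 c1] := coord01 h i x.
have k1 : k%:R / q%:R <= 1 :> R by rewrite ler_pdivrMr // mul1r ler_nat ltnW // ltnW.
have k0 : 0 <= k%:R / q%:R :> R by rewrite divr_ge0.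
have Mc0 : 0 <= M%:R * coord h i x by rewrite mulr_ge0.
have McM : M%:R * coord h i x <= M%:R by rewrite ler_piMr.
by rewrite -2!natr1 /offset; apply/andP; split; lra.
Qed.

Let V : set (set X) := range (@piece R X J M.+2 r stagger).

Let stagger_cont j : continuous (stagger j).
Proof. exact: continuous_offset. Qed.
Let stagger_ge0 j x : 0 <= stagger j x.
Proof. by have /andP[] := @offset_bounds j.1 (nth 1%g s j.1) j.2 x (ltn_ord _). Qed.
Let stagger_lt j x : stagger j x < M.+2%:R.
Proof. by have /andP[] := @offset_bounds j.1 (nth 1%g s j.1) j.2 x (ltn_ord _). Qed.

Lemma stagger_cover : finite_open_cover V.
Proof.
split.
- exact/finite_image/finite_finset.
- by move=> _ [p _ <-]; exact: open_piece.
- apply/seteqP; split=> // x _.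
  have [p px] := pieces_cover stagger_ge0 stagger_lt r_gt0 x.
  by exists (piece r stagger p) => //; exists p.
Qed.

Lemma stagger_refines (U : set (set X)) (e : R) : (0 < M)%N -> M%:R^-1 <= e ->
  (forall x, exists2 A, U A & near_config s e x `<=` A) -> refines V U.
Proof.
move=> M0 Me leb _ [p _ <-].
have [->|/set0P[x px]] := eqVneq (piece r stagger p) set0.
  by have [A UA _] := leb point; exists A.
have [A UA sub] := leb x; exists A => // x' px'; apply: sub => h i hs.
have hi : (index h s < size s)%N by rewrite index_mem.
have := piece_diam r_le (Ordinal hi, i) px px'.
rewrite /stagger /offset /= nth_index // => lt1; apply: lt_le_trans Me.
rewrite -[ltRHS]mul1r ltr_pdivlMr ?ltr0n //.
rewrite -[X in _ * X](ger0_norm (ler0n R M)) -normrM.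
by move: lt1; congr (`|_| < _); ring.
Qed.

Lemma cover_ord_stagger x :
  cover_ord R V x <= \sum_(j : J) \1_(near_integer r stagger j) x.
Proof.
have -> : \sum_(j : J) \1_(near_integer r stagger j) x =
    (\sum_(j : J) (x \in near_integer r stagger j))%N%:R :> R.
  by rewrite natr_sum; apply: eq_bigr => j _; rewrite indicE.
have [finV _ _] := stagger_cover.
have := @cover_ord_ubound R _ V x _ (@piece R X J M.+2 r stagger) _ finV.
apply => //.
exact: card_pieces.
Qed.

Definition window (k : nat) (i : 'I_d) : set X :=
  [set x | exists a : nat, `|offset k (coord 1%g i x) - a%:R| < r].

(** Closeness to a mark at the group element g is the translate by the shift of
    the corresponding event at 1; this is where invariance will enter. *)
Lemma near_integer_shift (j : J) : near_integer r stagger j =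
  shift_action G (unit_cube R d) (nth 1%g s j.1)^-1%g @^-1` window j.1 j.2.
Proof.
by apply/seteqP; split=> x; rewrite /window /near_integer /stagger /coord /=
  /shift_map invgK mulg1.
Qed.

Lemma open_window k i : open (window k i).
Proof.
exact (@open_near_integer R X unit r (fun _ x => offset k (coord 1%g i x))
  (fun=> @continuous_offset k 1%g i) tt).
Qed.

(** If z - k / q is close to the mark a and z - l / q to the mark b, then k / q + a
    and l / q + b differ by less than 2 r = 1 / q; multiplied by q both are
    integers, so k + a q = l + b q, and k = l modulo q. *)
Lemma window_disjoint (i : 'I_d) (k l : nat) x : (k < q)%N -> (l < q)%N ->
  window k i x -> window l i x -> k = l.
Proof.
move=> kq lq [a /ltr_normlP[a1 a2]] [b /ltr_normlP[b1 b2]].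
set t := coord 1%g i x in a1 a2 b1 b2.
have rq : r * q%:R = 2^-1 by rewrite /r invfM mulfVK // gt_eqF.
have kE : k%:R = k%:R / q%:R * q%:R :> R by rewrite divfK // gt_eqF.
have lE : l%:R = l%:R / q%:R * q%:R :> R by rewrite divfK // gt_eqF.
have close (z w : R) : z < w + 2 * r -> z * q%:R < w * q%:R + 1.
  rewrite (_ : _ + 1 = (w + 2 * r) * q%:R) ?ltr_pM2r //.
  by rewrite mulrDl -mulrA rq divff.
have ab : (k + a * q = l + b * q)%N.
  apply/eqP; rewrite eqn_leq; apply/andP; split; apply: (@leq_of_ltD1 R).
    rewrite !natrD !natrM [k%:R]kE [l%:R]lE -!mulrDl; apply: close.
    by rewrite /offset in a1 a2 b1 b2; lra.
  rewrite !natrD !natrM [k%:R]kE [l%:R]lE -!mulrDl; apply: close.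
  by rewrite /offset in a1 a2 b1 b2; lra.
by have := congr1 (modn^~ q) ab; rewrite /= ![(_ + _ * q)%N]addnC !modnMDl !modn_small.
Qed.

Local Open Scope ereal_scope.

Lemma sum_window (mu : probability (borel X) R) (i : 'I_d) :
  \sum_(k < size s) mu (window k i) <= 1.
Proof.
have mW k : measurable (window k i : set (borel X)).
  by apply: sub_sigma_algebra; exact: open_window.
have mU : measurable (\big[setU/set0]_(k < size s) (window k i : set (borel X))).
  by apply: bigsetU_measurable => k _; exact: mW.
rewrite -(measure_semi_additive_ord mu (F := fun k : 'I_(size s) => window k i)) //.
  exact: probability_le1.
move=> k l _ _ [x [xk xl]]; apply: val_inj.
by apply: (window_disjoint _ _ xk xl); rewrite ltnS ltnW.
Qed.

Lemma integral_stagger (mu : probability (borel X) R) :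
  invariant_prob (shift_action G (unit_cube R d)) mu ->
  \int[mu]_x (cover_ord R V x)%:E <= d%:R%:E.
Proof.
move=> mu_inv.
have mW (j : J) : measurable (window j.1 j.2 : set (borel X)).
  by apply: sub_sigma_algebra; exact: open_window.
have Eo j : open (near_integer r stagger j).
  by apply: open_near_integer; exact: stagger_cont.
have H0 := @integral_cover_ord_le R _ mu V J (near_integer r stagger).
have H1 := H0 stagger_cover.
have H2 := H1 Eo.
have H3 := H2 cover_ord_stagger.
apply: (le_trans H3).
rewrite (eq_bigr (fun j : J => mu (window j.1 j.2))); last first.
  move=> j _. rewrite near_integer_shift. apply: mu_inv. exact: mW.
rewrite -(pair_big xpredT xpredT (fun (k : 'I_(size s)) i => mu (window k i))) /=.
rewrite exchange_big /=.
apply: (@le_trans _ _ (\sum_(i < d) 1)).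
  by apply: lee_sum => i _; exact: sum_window.
by rewrite sumEFin sumr_const card_ord.
Qed.
End upper_bound.

(** * The two inequalities *)

Section main.
Variables (R : realType) (G : groupType) (d : nat).
Local Notation X := ({ptws G -> unit_cube R d} : ptopologicalType).
Local Notation shift := (shift_action G (unit_cube R d)).
Local Open Scope ereal_scope.

Lemma dyn_dim_le : dyn_dim R shift <= d%:R%:E.
Proof.
apply: ge_ereal_sup => _ [U Uc <-].
have [s [e [e0 leb]]] := lebesgue_number Uc.
have := near_infty_natSinv_lt (PosNum e0) => -[n _ /(_ n (leqnn n))] /= ne.
apply: le_trans (ereal_inf_lbound _) _.
  exists (range (@piece R X ('I_(size s) * 'I_d)%type n.+3
    (2 * (size s).+1%:R)^-1 (@stagger R G d s n.+1))); last by reflexivity.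
  split; first exact: stagger_cover.
  by apply: (@stagger_refines R G d s n.+1 U e _ (ltW ne)).
apply: ge_ereal_sup => _ [mu mu_inv <-].
exact: integral_stagger.
Qed.

Lemma dirac_invariant (x : X) : (forall g, shift g x = x) ->
  invariant_prob shift (@dirac _ (borel X) x R).
Proof.
move=> fx g A mA; rewrite /= !diracE; congr (_ %:E).
by congr (nat_of_bool _)%:R; have /= e := fx g; apply/idP/idP; rewrite !inE /= e.
Qed.

Lemma dyn_dim_ge : d%:R%:E <= dyn_dim R shift.
Proof.
apply: le_trans (ereal_sup_ubound _); last first.
  by exists (range (@wall_avoiding R G d)); [exact: wall_avoiding_cover|reflexivity].
apply: le_ereal_inf_tmp => _ [V [Vc Vref] <-].
have [n [v dv]] := lebesgue_covering Vc Vref.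
apply: le_trans (ereal_sup_ubound _); last first.
  exists (@dirac _ (borel X) (grid_config R n v : X) R); last by reflexivity.
  by apply: dirac_invariant => g; exact: grid_config_fixed.
rewrite integral_dirac //; last first.
  by apply/measurable_EFinP; exact: measurable_cover_ord.
by rewrite diracT mul1e lee_fin.
Qed.

End main.

Theorem theorem8p1 (R : realType) (G : groupType) (hG : countable [set: G])
  (d : nat) (hd : (0 < d)%N) :
  dyn_dim R (shift_action G (unit_cube R d)) = (d%:R)%:E.
Proof. by apply/eqP; rewrite eq_le dyn_dim_le dyn_dim_ge. Qed.
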